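(* Let $A$ be an idiom and let $\mathscr{F}$ be a set of intervals of $A$. Then $\mathscr{F}=\mathscr{F}_j$ for some nucleus $j\in N(A)$ if and only if $\mathscr{F}$ satisfies the following four conditions: (i) for all $l,r\in A$: $[l\wedge r,l]\in\mathscr{F}$ if and only if $[r,r\vee l]\in\mathscr{F}$; (ii) if $[a,b]\in\mathscr{F}$ and $a\le x\le b$, then $[a,x]\in\mathscr{F}$; (iv) if $[a,b]\in\mathscr{F}$ and $c\in A$ is such that $a\le b\le c$ and $b$ is essential in $[a,c]$, then $[a,c]\in\mathscr{F}$; (v) if $b\in A$ and $X\subseteq A$ is a set of elements $x\le b$ with $[x,b]\in\mathscr{F}$ for all $x\in X$, then $[\bigwedge X,b]\in\mathscr{F}$ (for $X=\emptyset$ the infimum is taken in $[0,b]$, i.e. $[b,b]\in\mathscr{F}$). In this case $j=\bigwedge\{\chi(a,1)\mid [a,1]\in\mathscr{F}\}$.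
   Context: An idiom is a complete lattice $A$ (least element $0$, greatest element $1$) that is modular, i.e. $a\le b$ implies $(a\vee c)\wedge b=a\vee(c\wedge b)$, and upper continuous, i.e. $a\wedge\bigvee X=\bigvee\{a\wedge x\mid x\in X\}$ for all $a\in A$ and all directed $X\subseteq A$. For $a\le b$ in $A$, $[a,b]=\{x\in A\mid a\le x\le b\}$ is an interval. An element $x\in[a,b]$ is essential in $[a,b]$ if for every $y\in[a,b]$, $x\wedge y=a$ implies $y=a$. A nucleus on $A$ is a monotone map $j:A\to A$ with $a\le j(a)$, $j(a\wedge b)\ge j(a)\wedge j(b)$ and $j\circ j=j$. $N(A)$ is the set of all nuclei ordered pointwise; it is a complete lattice (in fact a frame) in which infima are computed pointwise. For each interval $[a,b]$ there is a largest nucleus $\chi(a,b)$ on $A$ such that $\chi(a,b)(a)\wedge b=a$. For a nucleus $j$, $\mathscr{F}_j=\{[a,b]\mid j\le\chi(a,b)\}$. *)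

(* Defs.v *)
From HB Require Import structures.
From mathcomp Require Import all_boot all_order.
From mathcomp Require Import boolp classical_sets.

Set Implicit Arguments.
Unset Strict Implicit.
Unset Printing Implicit Defensive.

Import Order.Theory.

Local Open Scope classical_set_scope.
Local Open Scope order_scope.

Section Completeness.
Context {d : Order.disp_t} {A : tbLatticeType d}.

(* With these default values the library operators also give the right answer
   on the empty set. *)
Definition bigjoin (X : set A) : A := supremum \bot X.
Definition bigmeet (X : set A) : A := infimum \top X.

Definition directed (X : set A) : Prop :=
  X !=set0 /\ forall x y, X x -> X y -> exists z, [/\ X z, x <= z & y <= z].

End Completeness.

HB.mixin Record isIdiom (d : Order.disp_t) A of Order.TBLattice d A := {
  idiom_complete : forall X : set A, supremums X !=set0;
  idiom_modular : forall a b c : A,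
    a <= b -> (a `|` c) `&` b = a `|` (c `&` b);
  idiom_upper_continuous : forall (a : A) (X : set A), directed X ->
    a `&` bigjoin X = bigjoin [set a `&` x | x in X]
}.

#[short(type="idiomType")]
HB.structure Definition Idiom (d : Order.disp_t) :=
  {A of Order.TBLattice d A & isIdiom d A}.

Section IdiomTheory.
Context {d : Order.disp_t} {A : idiomType d}.
Implicit Types (a b c x y : A) (X : set A).

Lemma bigjoinP X : supremums X (bigjoin X).
Proof.
rewrite /bigjoin /supremum; case: eqP => [->|_].
  by split => [x []|y _]; exact: le0x.
by have [s Xs] := idiom_complete X; case: xgetP => [_ -> //|/(_ s)].
Qed.

Lemma le_bigjoin X x : X x -> x <= bigjoin X.
Proof. by have [ubX _] := bigjoinP X; apply: ubX. Qed.

Lemma bigjoin_le X y : (forall x, X x -> x <= y) -> bigjoin X <= y.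
Proof. by have [_ leX] := bigjoinP X; apply: leX. Qed.

Lemma idiom_complete_inf X : infimums X !=set0.
Proof.
exists (bigjoin (lbound X)); split => [x Xx|y Xy]; last exact: le_bigjoin.
by apply: bigjoin_le => y; apply.
Qed.

Lemma bigmeetP X : infimums X (bigmeet X).
Proof.
rewrite /bigmeet /infimum; case: eqP => [->|_].
  by split => [x []|y _]; exact: lex1.
by have [s Xs] := idiom_complete_inf X; case: xgetP => [_ -> //|/(_ s)].
Qed.

Lemma bigmeet_le X x : X x -> bigmeet X <= x.
Proof. by have [lbX _] := bigmeetP X; apply: lbX. Qed.

Lemma le_bigmeet X y : (forall x, X x -> y <= x) -> y <= bigmeet X.
Proof. by have [_ geX] := bigmeetP X; apply: geX. Qed.

End IdiomTheory.

Section Intervals.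
Context {d : Order.disp_t} {A : idiomType d}.

Definition itv (a b : A) : set A := [set x | a <= x <= b].

Definition intervals : set (set A) :=
  [set I | exists a b, a <= b /\ I = itv a b].

Definition essential (x a b : A) : Prop :=
  itv a b x /\ forall y, itv a b y -> x `&` y = a -> y = a.

Lemma itv_inj (a b a' b' : A) :
  a <= b -> itv a b = itv a' b' -> a = a' /\ b = b'.
Proof.
move=> ab E.
have /andP[a'a _] : itv a' b' a by rewrite -E /itv /= lexx.
have /andP[_ bb'] : itv a' b' b by rewrite -E /itv /= lexx ab.
have a'b' : a' <= b' by exact: le_trans (le_trans a'a ab) bb'.
have /andP[aa' _] : itv a b a' by rewrite E /itv /= lexx.
have /andP[_ b'b] : itv a b b' by rewrite E /itv /= lexx a'b'.
by split; apply/le_anti/andP.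
Qed.

End Intervals.

Record nucleus {d : Order.disp_t} (A : idiomType d) := Nucleus {
  nucleus_fun :> A -> A;
  nucleus_mono : forall a b, a <= b -> nucleus_fun a <= nucleus_fun b;
  nucleus_ge : forall a, a <= nucleus_fun a;
  nucleus_meet : forall a b,
    nucleus_fun a `&` nucleus_fun b <= nucleus_fun (a `&` b);
  nucleus_idem : forall a, nucleus_fun (nucleus_fun a) = nucleus_fun a
}.

HB.instance Definition _ d (A : idiomType d) := gen_eqMixin (nucleus A).
HB.instance Definition _ d (A : idiomType d) := gen_choiceMixin (nucleus A).

Section NucleusOrder.
Context {d : Order.disp_t} {A : idiomType d}.
Implicit Types j k : nucleus A.

Lemma nucleus_eq j k : (forall a, j a = k a) -> j = k.
Proof.
case: j k => [f f1 f2 f3 f4] [g g1 g2 g3 g4] /= /funext fg.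
by case: _ / fg in g1 g2 g3 g4 *; congr Nucleus; exact: Prop_irrelevance.
Qed.

Definition nucleus_le : rel (nucleus A) := fun j k => `[< forall a, j a <= k a >].

Fact nucleus_le_refl : reflexive nucleus_le.
Proof. by move=> j; apply/asboolP. Qed.

Fact nucleus_le_anti : antisymmetric nucleus_le.
Proof.
move=> j k /andP[/asboolP jk /asboolP kj]; apply: nucleus_eq => a.
by apply/le_anti; rewrite jk kj.
Qed.

Fact nucleus_le_trans : transitive nucleus_le.
Proof.
move=> k j l /asboolP jk /asboolP kl; apply/asboolP => a.
exact: le_trans (jk a) (kl a).
Qed.

End NucleusOrder.

HB.instance Definition _ (d : Order.disp_t) (A : idiomType d) :=
  Order.Le_isPOrder.Build d (nucleus A)
    nucleus_le_refl nucleus_le_anti nucleus_le_trans.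

Section Nuclei.
Context {d : Order.disp_t} {A : idiomType d}.
Implicit Types (j k : nucleus A) (a b x : A).

Lemma nucleus_leP j k : reflect (forall a, j a <= k a) (j <= k).
Proof. exact: asboolP. Qed.

Section Inf.
Variable J : set (nucleus A).

Let f x := bigmeet [set k x | k in J].

Let f_mono a b : a <= b -> f a <= f b.
Proof.
move=> ab; apply: le_bigmeet => _ [k Jk <-].
by apply: le_trans (nucleus_mono k ab); apply: bigmeet_le; exists k.
Qed.

Let f_ge a : a <= f a.
Proof. by apply: le_bigmeet => _ [k _ <-]; exact: nucleus_ge. Qed.

Let f_meet a b : f a `&` f b <= f (a `&` b).
Proof.
apply: le_bigmeet => _ [k Jk <-]; apply: le_trans (nucleus_meet _ _ _).
by apply: leI2; apply: bigmeet_le; exists k.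
Qed.

Let f_idem a : f (f a) = f a.
Proof.
apply/le_anti; rewrite f_ge andbT; apply: le_bigmeet => _ [k Jk <-].
rewrite -(nucleus_idem k); apply: (@le_trans _ _ (k (f a))).
  by apply: bigmeet_le; exists k.
by apply: nucleus_mono; apply: bigmeet_le; exists k.
Qed.

Definition nucleus_inf : nucleus A := Nucleus f_mono f_ge f_meet f_idem.

Lemma nucleus_infP : infimums J nucleus_inf.
Proof.
split => [k Jk|k kJ]; apply/nucleus_leP => a.
  by apply: bigmeet_le; exists k.
by apply: le_bigmeet => _ [l Jl <-]; exact/nucleus_leP/kJ.
Qed.

End Inf.

(* The largest nucleus with k a `&` b = a is the pointwise join of all
   prenuclei p with p a `&` b = a, which form a directed family since they are
   closed under composition. *)
Lemma chi_exists (a b : A) : a <= b ->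
  exists k, k a `&` b = a /\ forall j, j a `&` b = a -> j <= k.
Proof.
move=> ab.
pose P := [set p : A -> A | [/\ {homo p : x y / x <= y}, (forall x, x <= p x),
  (forall x y, p x `&` p y <= p (x `&` y)) & p a `&` b = a]].
have Pid : P id by split=> //; exact/meet_idPl.
have Pcomp p q : P p -> P q -> P (p \o q).
  move=> [p1 p2 p3 p4] [q1 q2 q3 q4]; split=> /= [x y xy|x|x y|].
  - exact/p1/q1.
  - exact: le_trans (q2 x) (p2 _).
  - exact: le_trans (p3 _ _) (p1 _ _ (q3 _ _)).
  apply/le_anti/andP; split; last by rewrite lexI ab (le_trans (q2 a) (p2 _)).
  rewrite -[leRHS]p4 lexI leIr andbT -{2}q4.
  by apply: le_trans (p3 _ _); apply: leI2.
pose s x := bigjoin [set p x | p in P].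
have le_s p x : P p -> p x <= s x by move=> Pp; apply: le_bigjoin; exists p.
have dirP x : directed [set p x | p in P].
  split; first by exists x, id.
  move=> _ _ [p Pp <-] [q Pq <-]; exists ((p \o q) x).
  have [p1 p2 _ _] := Pp; have [q1 q2 _ _] := Pq.
  split; [by exists (p \o q) => //; exact: Pcomp| |exact: p2].
  exact/p1/q2.
have Ps : P s.
  split=> [x y xy|x|x y|].
  - apply: bigjoin_le => _ [p Pp <-].
    by apply: le_trans (le_s _ _ Pp); case: Pp => + _ _ _; apply.
  - exact: le_s Pid.
  - rewrite [s y]/s (idiom_upper_continuous _ _ (dirP y)).
    apply: bigjoin_le => _ [_ [q Pq <-] <-].
    rewrite meetC (idiom_upper_continuous _ _ (dirP x)).
    apply: bigjoin_le => _ [_ [p Pp <-] <-].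
    have [p1 p2 _ _] := Pp; have [q1 q2 _ _] := Pq.
    have [_ _ pq3 _] := Pcomp _ _ Pp Pq.
    apply: le_trans (le_s _ _ (Pcomp _ _ Pp Pq)).
    apply: le_trans (pq3 _ _); rewrite meetC; apply: leI2; last exact: p2.
    exact/p1/q2.
  apply/le_anti/andP; split; last by rewrite lexI ab andbT; exact: le_s Pid.
  rewrite meetC (idiom_upper_continuous _ _ (dirP a)).
  apply: bigjoin_le => _ [_ [p [_ _ _ pa] <-] <-].
  by rewrite meetC pa.
have [s1 s2 s3 s4] := Ps.
have s_idem x : s (s x) = s x.
  by apply/le_anti; rewrite s2 andbT; exact: le_s (Pcomp _ _ Ps Ps).
exists (Nucleus s1 s2 s3 s_idem); split=> // j ja.
apply/nucleus_leP => x; apply: le_s; split => //.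
- by move=> *; exact: nucleus_mono.
- exact: nucleus_ge.
- exact: nucleus_meet.
Qed.

(* The side condition a <= b is necessary for such a nucleus to exist;
   otherwise chi a b has an unspecified value. *)
Definition chi (a b : A) : nucleus A :=
  xget (nucleus_inf set0)
    [set k : nucleus A | k a `&` b = a /\
       forall j : nucleus A, j a `&` b = a -> j <= k].

Lemma chiP (a b : A) : a <= b ->
  chi a b a `&` b = a /\ forall j, j a `&` b = a -> j <= chi a b.
Proof.
move=> /chi_exists[k Pk]; rewrite /chi.
by case: xgetP => [_ -> //|/(_ k)]; case.
Qed.

Definition nucleus_itvs j : set (set A) :=
  [set I | exists a b, [/\ a <= b, I = itv a b & j <= chi a b]].

End Nuclei.

(* Main.v *)
Require Import Defs.
From mathcomp Require Import all_boot all_order.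
From mathcomp Require Import boolp classical_sets.

(** An interval [[a, b]] lies in [nucleus_itvs j] iff [j a `&` b = a], so
    conditions (i)-(v) for [nucleus_itvs j] are short computations, and the
    tops [[a, \top]] in it are given by the fixed points [a] of [j].
    Conversely, by (v) the set [S] of all [s] with [F [s, \top]] is closed
    under meets, hence is the set of closed elements of a closure operator [j].
    The key step is to extend [c0] with [c0 `&` b = a], where [F [a, b]], to a
    maximal [c] with [c `&` b = a] (upper continuity and Zorn): then
    [b `|` c] is essential in [[c, \top]], so (i) and (iv) put [c] in [S].
    With [c0 = a] this gives [j a `&` b = a], and with [c0 = y `|` (x `&` s)]
    and [b = x] it shows that [j] preserves meets. *)

Local Open Scope classical_set_scope.
Local Open Scope order_scope.
Import Order.Theory.

Section Prelim.
Set Implicit Arguments.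
Unset Strict Implicit.
Context {d : Order.disp_t} {A : idiomType d}.
Implicit Types (a b c s x y : A) (X : set A) (j : nucleus A).

(** Zorn's lemma on the elements above [c] that meet [b] in [a]. A nonempty chain is directed, so by
    upper continuity its join still meets [b] in [a]. *)
Lemma exists_max_pseudocomplement a b c : c `&` b = a ->
  exists m, [/\ c <= m, m `&` b = a &
    forall y, m <= y -> y `&` b = a -> y = m].
Proof.
move=> cb.
pose T := {x : A | c <= x /\ x `&` b = a}.
pose R (u v : T) := sval u <= sval v.
have [||| |m mP] := @Zorn T R.
- by move=> u; rewrite /R.
- by move=> u v w; rewrite /R; exact: le_trans.
- by move=> [u Pu] [v Pv] /= uv vu; apply/eq_exist/le_anti/andP.
(* The empty chain is bounded by [c] itself. *)
- move=> C totC; have [[u Cu]|C0] := pselect (C !=set0); last first.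
    exists (exist _ c (conj (lexx c) cb)) => s Cs.
    by case: C0; exists s.
  pose X := [set sval v | v in C].
  have dirX : directed X.
    split; first by exists (sval u), u.
    move=> _ _ [v Cv <-] [w Cw <-]; have [vw|wv] := totC _ _ Cv Cw.
      by exists (sval w); split => //; exists w.
    by exists (sval v); split => //; exists v.
  have Xu : X (sval u) by exists u.
  have cX : c <= bigjoin X.
    by apply: le_trans (le_bigjoin Xu); case: (svalP u).
  have Xb : bigjoin X `&` b = a.
    apply/le_anti/andP; split.
      rewrite meetC idiom_upper_continuous//.
      apply: bigjoin_le => _ [_ [v Cv <-] <-].
      by rewrite meetC; have [_ ->] := svalP v.
    by rewrite -cb; exact: leI2.
  exists (exist _ (bigjoin X) (conj cX Xb)) => v Cv.
  by apply: le_bigjoin; exists v.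
case: m mP => m [cm mb] mP; exists m; split=> // y my yb.
have := mP (exist _ y (conj (le_trans cm my) yb)) my.
by move=> /(congr1 sval).
Qed.

(** The defining property of [chi a b] passes down to smaller nuclei, since [a <= j a] and
    [a <= b]. *)
Lemma le_chi j a b : a <= b -> (j <= chi a b) <-> j a `&` b = a.
Proof.
move=> ab; have [chia chi_max] := chiP ab; split=> [/nucleus_leP jchi|]; last first.
  exact: chi_max.
apply/le_anti/andP; split; last by rewrite lexI nucleus_ge.
by rewrite -{2}chia; exact: leI2.
Qed.

Lemma nucleus_itvsE j a b :
  nucleus_itvs j (itv a b) <-> a <= b /\ j a `&` b = a.
Proof.
split=> [[a' [b' [ab' /esym E jchi]]]|[ab jab]].
  by have [<- <-] := itv_inj ab' E; split=> //; exact/le_chi.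
by exists a, b; split=> //; exact/le_chi.
Qed.

Lemma infimum_le b X x : X x -> infimum b X <= x.
Proof.
move=> Xx; rewrite /infimum; case: eqP => [X0|_]; first by rewrite X0 in Xx.
have [i Xi] := idiom_complete_inf X.
by case: xgetP => [_ -> [lbX _]|/(_ i)//]; exact: lbX.
Qed.

(** The bound [y <= b] settles the case of empty [X], where the infimum is the default [b]. *)
Lemma le_infimum b X y : y <= b -> (forall x, X x -> y <= x) ->
  y <= infimum b X.
Proof.
move=> yb yX; rewrite /infimum; case: eqP => // _.
have [i Xi] := idiom_complete_inf X.
by case: xgetP => [_ -> [_ geX]|/(_ i)//]; exact: geX.
Qed.

Lemma infimum_le_default b X : (forall x, X x -> x <= b) -> infimum b X <= b.
Proof.
move=> Xb; have [[x Xx]|/set0P/negP/negPn/eqP X0] := pselect (X !=set0).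
  exact: le_trans (infimum_le _ Xx) (Xb _ Xx).
by rewrite /infimum X0 eqxx.
Qed.

Lemma nucleus_itvs_transpose j (l r : A) :
  nucleus_itvs j (itv (l `&` r) l) <-> nucleus_itvs j (itv r (r `|` l)).
Proof.
rewrite !nucleus_itvsE; split=> [[_ jlr]|[_ jr]].
  split; first exact: leUl.
  (* Modularity turns the goal into [l]&[j r <= r], and this meet lies below both [j (l]&[r)] and
     [l]. *)
  rewrite meetC idiom_modular ?nucleus_ge//; apply/join_idPl.
  apply: (@le_trans _ _ (j (l `&` r) `&` l)); last by rewrite jlr; exact: leIr.
  rewrite lexI leIl andbT; apply: le_trans (nucleus_meet _ _ _).
  by apply: leI2 => //; exact: nucleus_ge.
split; first exact: leIl.
apply/le_anti/andP; split; last by rewrite lexI nucleus_ge leIl.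
rewrite lexI leIr /= -{2}jr; apply: leI2; last exact: leUr.
by apply: nucleus_mono; exact: leIr.
Qed.

(** The element [j a]&[c] of [[a, c]] meets [b] in [j a]&[b = a], so essentiality makes it equal to
    [a]. *)
Lemma nucleus_itvs_essential j a b c :
  nucleus_itvs j (itv a b) -> essential b a c -> nucleus_itvs j (itv a c).
Proof.
rewrite !nucleus_itvsE => -[ab jab] [/andP[_ bc] bess].
have ac := le_trans ab bc; split=> //; apply: bess.
  by rewrite /itv /= lexI nucleus_ge ac leIr.
by rewrite meetCA [b `&` c]meet_l.
Qed.

Lemma nucleus_itvs_infimum j b X :
  (forall x, X x -> x <= b /\ nucleus_itvs j (itv x b)) ->
  nucleus_itvs j (itv (infimum b X) b).
Proof.
move=> Xb; have ib : infimum b X <= b.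
  by apply: infimum_le_default => x /Xb[].
apply/nucleus_itvsE; split=> //.
apply/le_anti; rewrite lexI nucleus_ge ib !andbT.
apply: le_infimum => [|x Xx]; first exact: leIr.
have [_ /nucleus_itvsE[_ <-]] := Xb _ Xx.
by apply: leI2 => //; apply: nucleus_mono; exact: infimum_le.
Qed.

Lemma nucleus_eq_inf_chi j :
  j = nucleus_inf [set chi a \top | a in [set a | nucleus_itvs j (itv a \top)]].
Proof.
have [infle leinf] := nucleus_infP
  [set chi a \top | a in [set a | nucleus_itvs j (itv a \top)]].
apply/le_anti/andP; split.
  apply: leinf => _ [a /= /nucleus_itvsE[a1 ja] <-]; exact/le_chi.
apply/nucleus_leP => x.
(* The member of the family indexed by the fixed point [j x] is already at most [j x] at [x],
   because it fixes [j x]. *)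
have Sjx : nucleus_itvs j (itv (j x) \top).
  by apply/nucleus_itvsE; rewrite lex1 meetx1 nucleus_idem.
have /nucleus_leP/(_ x) := infle _ (ex_intro2 _ _ (j x) Sjx erefl).
have [chijx _] := chiP (lex1 (j x)); rewrite meetx1 in chijx.
move/le_trans; apply; rewrite -[leRHS]chijx.
by apply: nucleus_mono; exact: nucleus_ge.
Qed.

End Prelim.

Section Converse.
Set Implicit Arguments.
Unset Strict Implicit.
Context {d : Order.disp_t} {A : idiomType d}.
Variable F : set (set A).
Hypothesis F_itv : F `<=` intervals.
Hypothesis F_transpose :
  forall l r : A, F (itv (l `&` r) l) <-> F (itv r (r `|` l)).
Hypothesis F_sub :
  forall a b x : A, F (itv a b) -> a <= x -> x <= b -> F (itv a x).
Hypothesis F_essential : forall a b c : A,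
  F (itv a b) -> a <= b -> b <= c -> essential b a c -> F (itv a c).
Hypothesis F_infimum : forall (b : A) (X : set A),
  (forall x, X x -> x <= b /\ F (itv x b)) -> F (itv (infimum b X) b).

Let S : set A := [set s | F (itv s \top)].

Lemma extend_to_top (a b c : A) : F (itv a b) -> c `&` b = a ->
  exists m, [/\ c <= m, m `&` b = a & S m].
Proof.
move=> Fab cb.
have [m [cm mb mmax]] := exists_max_pseudocomplement cb.
exists m; split=> //; apply: (@F_essential _ (m `|` b)).
(* The interval from [m] to [m]|[b] is the transpose of [[b]&[m, b] = [a, b]]. *)
- by apply/F_transpose; rewrite meetC mb.
- exact: leUl.
- exact: lex1.
split=> [|y /andP[my _] mby]; first by rewrite /itv /= leUl lex1.
(* If [y >= m] meets [m]|[b] in [m], then [y]&[b] lies below [m] and [b], hence equals [a], and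
   maximality of [m] applies. *)
apply: mmax => //; apply/le_anti/andP; split.
  rewrite -mb lexI leIr andbT -mby lexI leIl andbT.
  by apply: le_trans (leUr _ _); exact: leIr.
by rewrite -mb; exact: leI2.
Qed.

(** Cut [[s, \top]] down to [[s, s]|[x]] by (ii), then transpose by (i). *)
Lemma restrict_from_top (s x : A) : S s -> F (itv (x `&` s) x).
Proof. by move=> Ss; apply/F_transpose/(F_sub Ss); rewrite ?leUl ?lex1. Qed.

Let f x := bigmeet [set s | S s /\ x <= s].

Let f_le x s : S s -> x <= s -> f x <= s.
Proof. by move=> Ss xs; exact: bigmeet_le. Qed.

Let f_ge x : x <= f x.
Proof. by apply: le_bigmeet => s []. Qed.

Let f_mono x y : x <= y -> f x <= f y.
Proof.
by move=> xy; apply: le_bigmeet => s [Ss ys]; apply: f_le => //; exact: le_trans ys.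
Qed.

(** [bigmeet] unfolds to the infimum with default [\top], so this is (v) at [b = \top]. *)
Let S_f x : S (f x).
Proof. by apply: F_infimum => s [Ss _]; split=> //; exact: lex1. Qed.

Let f_idem x : f (f x) = f x.
Proof. by apply/le_anti; rewrite f_ge andbT; exact: f_le. Qed.

(** By modularity [x]&[s]|[y] meets [x] in [x]&[s]. Its extension [m] in [S] does too and lies above
    [f y], so [x]&[f y <= x]&[m <= s]. *)
Let meet_f_le x y s : S s -> x `&` y <= s -> x `&` f y <= s.
Proof.
move=> Ss xys.
have E : (x `&` s `|` y) `&` x = x `&` s.
  rewrite idiom_modular ?leIl//; apply/join_idPl.
  by rewrite lexI leIr meetC.
have [m [ym mx Sm]] := extend_to_top (restrict_from_top x Ss) E.
apply: le_trans (leIr s x); rewrite -mx meetC; apply: leI2 => //.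
by apply: f_le => //; exact: le_trans (leUr _ _) ym.
Qed.

Let f_meet x y : f x `&` f y <= f (x `&` y).
Proof.
(* The closure is introduced on one factor at a time, with [s = f (x]&[y)] both times. *)
apply: (meet_f_le (S_f _)); rewrite meetC.
by apply: (meet_f_le (S_f _)); rewrite meetC.
Qed.

Lemma exists_nucleus : exists j : nucleus A, F = nucleus_itvs j.
Proof.
pose j := Nucleus f_mono f_ge f_meet f_idem; exists j.
apply/seteqP; split=> [I FI|_ [a [b [ab -> /(le_chi _ ab) /= <-]]]]; last first.
  by rewrite meetC; exact: restrict_from_top.
have [a [b [ab E]]] := F_itv FI; rewrite E in FI *.
apply/nucleus_itvsE; split=> //=.
(* Extending [a] itself gives [m] in [S] with [f a <= m], whence [f a]&[b <= m]&[b = a]. *)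
have [m [am mb Sm]] := extend_to_top FI (meet_l ab).
apply/le_anti; rewrite lexI f_ge ab !andbT -[leRHS]mb.
by apply: leI2 => //; exact: f_le.
Qed.

End Converse.

Theorem theorem3p18 (d : Order.disp_t) (A : idiomType d) (F : set (set A))
    (F_itv : F `<=` intervals) :
  ((exists j : nucleus A, F = nucleus_itvs j) <->
   [/\ (* (i) *)
       forall l r : A, F (itv (l `&` r) l) <-> F (itv r (r `|` l)),
       (* (ii) *)
       forall a b x : A, F (itv a b) -> a <= x -> x <= b -> F (itv a x),
       (* (iv) *)
       forall a b c : A, F (itv a b) -> a <= b -> b <= c ->
         essential b a c -> F (itv a c)
     & (* (v); infimum b X is b when X is empty, and the meet of X otherwise *)
       forall (b : A) (X : set A),
         (forall x, X x -> x <= b /\ F (itv x b)) ->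
         F (itv (infimum b X) b)]) /\
  (forall j : nucleus A, F = nucleus_itvs j ->
     j = nucleus_inf [set chi a \top | a in [set a : A | F (itv a \top)]]).
Proof.
split; last by move=> j ->; exact: nucleus_eq_inf_chi.
split=> [[j ->]|[Fi Fii Fiv Fv]]; last exact: exists_nucleus.
split.
- exact: nucleus_itvs_transpose.
- move=> a b x /nucleus_itvsE[_ jab] ax xb; apply/nucleus_itvsE; split=> //.
  apply/le_anti; rewrite lexI nucleus_ge ax !andbT -[leRHS]jab.
  exact: leI2.
- by move=> a b c Fab _ _; exact: nucleus_itvs_essential.
- exact: nucleus_itvs_infimum.
Qed.
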